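(* For every power of two $d\ge256$, $\sup_{u\in S^{d-1}}W_1(T(u),X(u))>\frac13$; for every power of two $d\ge 32768$, $\sup_{u\in S^{d-1}}W_1(T(u),X(u))>0.6$. Moreover, \[ \liminf_{d\to\infty,\ d\in\{2^m:m\in\mathbb N\}}\ \sup_{u\in S^{d-1}}W_1\bigl(T(u),X(u)\bigr)\ge \sqrt{2\Bigl(1-\sqrt{\tfrac2\pi}\Bigr)}\approx0.6358 . \]
   Context: $H$ is the unnormalized $d\times d$ Walsh--Hadamard matrix ($H_1=(1)$, $H_{2n}=\begin{pmatrix}H_n&H_n\\H_n&-H_n\end{pmatrix}$). $D^{(1)},D^{(2)}$ are independent diagonal matrices with i.i.d. Rademacher diagonal entries. For deterministic $u\in S^{d-1}$ (the Euclidean unit sphere), $T(u)=\frac1d HD^{(1)}HD^{(2)}u$ and $X(u)=Ru$, with $R$ Haar-distributed on $\mathcal O(d)$. $W_1$ is the Wasserstein-1 distance with respect to the Euclidean norm: $W_1(Y,Z)=\sup_f|\mathbb{E}f(Y)-\mathbb{E}f(Z)|$ over $1$-Lipschitz $f:\mathbb{R}^d\to\mathbb{R}$. *)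

(* Defs.v *)
From HB Require Import structures.
From mathcomp Require Import all_boot all_order all_algebra.
From mathcomp Require Import all_classical all_reals all_analysis.
Set Implicit Arguments. Unset Strict Implicit. Unset Printing Implicit Defensive.
Import Order.TTheory GRing.Theory Num.Theory.
Import numFieldNormedType.Exports.
Local Open Scope classical_set_scope.
Local Open Scope ring_scope.

Section Defs.
Variable R : realType.

Definition enorm n (v : 'cV[R]_n) : R := Num.sqrt (\sum_(i < n) v i 0 ^+ 2).

Definition lip1 n (f : 'cV[R]_n -> R) : Prop :=
  forall x y, `|f x - f y| <= enorm (x - y).

Definition orthogonal_mx n (A : 'M[R]_n) : Prop := A^T *m A = 1%:M.

Lemma pow2S_eq m : (2 ^ m + 2 ^ m = 2 ^ m.+1)%N.
Proof. by rewrite expnS mul2n addnn. Qed.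

Fixpoint hadamard (m : nat) : 'M[R]_(2 ^ m) :=
  match m return 'M[R]_(2 ^ m) with
  | 0 => 1%:M
  | m'.+1 => castmx (pow2S_eq m', pow2S_eq m')
      (block_mx (hadamard m') (hadamard m') (hadamard m') (- hadamard m'))
  end.

Definition sign_diag n (s : {ffun 'I_n -> bool}) : 'M[R]_n :=
  diag_mx (\row_i ((-1) ^+ s i)).

(* T(u) for a fixed realization (s1, s2) of (D^(1), D^(2)), d = 2^m. *)
Definition Tmap m (s1 s2 : {ffun 'I_(2 ^ m) -> bool}) (u : 'cV[R]_(2 ^ m)) :
    'cV[R]_(2 ^ m) :=
  ((2 ^ m)%:R)^-1 *: (hadamard m *m sign_diag s1 *m hadamard m *m sign_diag s2 *m u).

(* E f(T(u)): D^(1), D^(2) independent with i.i.d. Rademacher diagonals, so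
   (s1, s2) is uniform on the 2^(2d) sign patterns. *)
Definition ET m (f : 'cV[R]_(2 ^ m) -> R) (u : 'cV[R]_(2 ^ m)) : R :=
  ((2 ^ (2 * 2 ^ m))%:R)^-1 *
  \sum_(s1 : {ffun 'I_(2 ^ m) -> bool}) \sum_(s2 : {ffun 'I_(2 ^ m) -> bool})
     f (Tmap s1 s2 u).

End Defs.

(* Measurable structure on square matrices: the sigma-algebra generated by the
   entries (= Borel sigma-algebra of R^(n*n)), as for tuples in the library. *)
Definition mxM (R : realType) (n : nat) : Type := 'M[R]_n.
HB.instance Definition _ (R : realType) n := Pointed.on (mxM R n).

Section mxM.
Variables (R : realType) (n : nat).
Let coor : 'I_(n * n) -> mxM R n -> R := fun k A => mxvec A 0 k.
Let mx_set0 : g_sigma_preimage coor set0.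
Proof. exact: sigma_algebra0. Qed.
Let mx_setC A : g_sigma_preimage coor A -> g_sigma_preimage coor (~` A).
Proof. exact: sigma_algebraC. Qed.
Let mx_bigcup (F : _^nat) : (forall i, g_sigma_preimage coor (F i)) ->
  g_sigma_preimage coor (\bigcup_i (F i)).
Proof. exact: sigma_algebra_bigcup. Qed.
HB.instance Definition _ := @isMeasurable.Build (measure_tuple_display default_measure_display)
  (mxM R n) (g_sigma_preimage coor) mx_set0 mx_setC mx_bigcup.
End mxM.

Local Open Scope classical_set_scope.
Local Open Scope ring_scope.

Definition haar_On (R : realType) n (P : probability (mxM R n) R) : Prop :=
  measurable [set A : mxM R n | orthogonal_mx A] /\
  P [set A : mxM R n | orthogonal_mx A] = 1%E /\
  forall Q : 'M[R]_n, orthogonal_mx Q ->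
    forall B : set (mxM R n), measurable B ->
      P [set A : mxM R n | B (Q *m A : mxM R n)] = P B.

Definition EX (R : realType) m (P : probability (mxM R (2 ^ m)) R)
    (f : 'cV[R]_(2 ^ m) -> R) (u : 'cV[R]_(2 ^ m)) : \bar R :=
  (\int[P]_(A in setT) (f ((A : 'M[R]_(2 ^ m)) *m u))%:E)%E.

Definition W1TX (R : realType) m (P : probability (mxM R (2 ^ m)) R)
    (u : 'cV[R]_(2 ^ m)) : \bar R :=
  ereal_sup [set `|(ET f u)%:E - EX P f u|%E | f in [set f | lip1 f]].

Definition supW1 (R : realType) m (P : probability (mxM R (2 ^ m)) R) : \bar R :=
  ereal_sup [set W1TX P u | u in [set u : 'cV[R]_(2 ^ m) | enorm u = 1]].

(* Main.v *)
Require Import Defs.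
From HB Require Import structures.
From mathcomp Require Import all_boot all_order all_algebra.
From mathcomp Require Import all_classical all_reals all_analysis.
From mathcomp Require Import measurable_realfun ring lra.
Import Order.TTheory GRing.Theory Num.Theory.
Import numFieldNormedType.Exports.
Local Open Scope classical_set_scope.
Local Open Scope ring_scope.

(* Take u = e_0. Since H has a constant first column, T(e_0) is uniform on the
   rotated cube d^-1 H {-1,1}^d, so the distance f to that finite set is
   1-Lipschitz with E f(T) = 0, and W_1 >= E f(X). On the sphere
   f(X)^2 = 2 - 2 Z with Z = |X|_1 / sqrt d, after absorbing the orthogonal
   matrix H / sqrt d by invariance. Two polynomial tangent inequalities give
   f >= k0 + k1 Z^2 - k2 Z^4, with equality at Z = b := sqrt (2 / pi), where
   the value is a := sqrt (2 - 2 b); so only a lower bound on E Z^2 and an upper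
   bound on E Z^4 are needed. Both come from averaging over rotations of a
   coordinate plane: E[|X_i X_j| g] = pi^-1 E[(X_i^2 + X_j^2) g] whenever g >= 0
   is invariant under rotations of the plane (i, j). This yields
   E Z^2 >= b^2, E Z^4 <= b^4 + 5 / d, and E f(X) >= a - 65 / d. *)

Set Implicit Arguments. Unset Strict Implicit. Unset Printing Implicit Defensive.

(** * Trigonometric integrals *)

Lemma integral_derivative (R : realType) (F f : R -> R) (a b : R) :
  a <= b -> continuous f -> (forall x : R, is_derive x (1 : R) F (f x)) ->
  (\int[lebesgue_measure]_(t in `[a, b]) (f t)%:E = (F b - F a)%:E)%E.
Proof.
rewrite le_eqVlt => /predU1P[<- _ _|ab cf dF].
  by rewrite set_itv1 integral_set1 subrr.
have cF : continuous F.
  by move=> x; apply/differentiable_continuous/derivable1_diffP; case: (dF x).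
rewrite EFinB; apply: continuous_FTC2 => //.
- exact: continuous_subspaceT.
- split=> [x _||]; first by case: (dF x).
    by apply: cvg_at_right_filter; exact: cF.
  by apply: cvg_at_left_filter; exact: cF.
- by move=> x _; rewrite derive1E; apply: derive_val.
Qed.

(** Split at [t = c], where [sin (c - t)] passes from nonnegative to nonpositive; the two pieces
    contribute [1 - cos c] and [1 + cos c]. *)
Lemma integral_abs_sinB (R : realType) (c : R) : 0 <= c <= pi ->
  (\int[lebesgue_measure]_(t in `[0%R, pi]) `|sin (c - t)|%:E = (2:R)%:E)%E.
Proof.
move=> /andP[c0 cpi].
have cs : continuous (fun t : R => sin (c - t)).
  move=> x; apply: (@continuous_comp _ _ _ (fun t => c - t) sin).
    by apply: continuousB => //; exact: cst_continuous.
  exact: continuous_sin.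
have dB x : is_derive x (1 : R) (fun t : R => c - t) (-1 : R).
  by apply: is_derive_eq; rewrite add0r mul1r.
have dcos x : is_derive x (1 : R) (fun t : R => cos (c - t)) (sin (c - x)).
  apply: is_derive_eq. rewrite /GRing.scale/=; ring.
have dNcos x : is_derive x (1 : R) (fun t : R => - cos (c - t)) (- sin (c - x)).
  apply: is_derive_eq. by [].
have cNs : continuous (fun t : R => - sin (c - t)).
  by move=> x; apply: continuousN; exact: cs.
have ms : measurable_fun setT (fun t : R => `|sin (c - t)|%:E).
  by apply/measurable_EFinP; apply: measurableT_comp => //;
    exact: continuous_measurable_fun.
rewrite (@itv_bndbnd_setU _ _ _ (BRight c)) ?bnd_simp//.
rewrite integral_setU//; last 2 first.
- exact: measurable_funTS.
- apply/disj_setPS => x [/=]; rewrite !in_itv/= => /andP[_ xc] /andP[cx _].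
  by move: cx; rewrite ltNge xc.
rewrite integral_itv_obnd_cbnd; last exact: measurable_funTS.
have E1 : (\int[lebesgue_measure]_(t in `[0%R, c]) `|sin (c - t)|%:E =
   (1 - cos c)%:E)%E.
  transitivity (\int[lebesgue_measure]_(t in `[0%R, c]) (sin (c - t))%:E)%E.
    apply: eq_integral => t; rewrite inE/= in_itv/= => /andP[t0 tc]; rewrite ger0_norm//.
    by apply: sin_ge0_pi; rewrite subr_ge0 tc/= lerBlDr (le_trans cpi)// lerDl.
  rewrite (integral_derivative c0 cs dcos) subrr cos0 subr0 //.
have E2 : (\int[lebesgue_measure]_(t in `[c, pi]) `|sin (c - t)|%:E =
   (1 + cos c)%:E)%E.
  transitivity (\int[lebesgue_measure]_(t in `[c, pi]) (- sin (c - t))%:E)%E.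
    apply: eq_integral => t; rewrite inE/= in_itv/= => /andP[t0 tc]; rewrite ler0_norm//.
    rewrite -oppr_ge0 -sinN opprB.
    by apply: sin_ge0_pi; rewrite subr_ge0 t0/= lerBlDr (le_trans tc)// lerDl.
  rewrite (integral_derivative cpi cNs dNcos) subrr cos0 cosB cospi sinpi.
  by rewrite mulr0 addr0 mulrN1 opprK addrC opprK.
by rewrite E1 E2 -EFinD; congr EFin; ring.
Qed.

(** The form is chosen so that p cos t + q sin t = r sin (c - t). A signed radius [r] lets the angle
    stay in [0, pi], as [integral_abs_sinB] requires. *)
Lemma polar_upper_half (R : realType) (p q : R) :
  exists2 c, 0 <= c <= pi & exists2 r, `|r| = Num.sqrt (p ^+ 2 + q ^+ 2) &
    p = r * sin c /\ q = - (r * cos c).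
Proof.
set s := p ^+ 2 + q ^+ 2.
have p2 := sqr_ge0 p; have q2 := sqr_ge0 q.
have s0 : 0 <= s by rewrite addr_ge0.
have [z|sn0] := eqVneq s 0.
  exists 0; rewrite ?lexx ?pi_ge0//; exists 0; rewrite ?z ?sqrtr0 ?normr0//.
  have /andP[] : (p ^+ 2 == 0) && (q ^+ 2 == 0).
    by move: z => /eqP; rewrite paddr_eq0.
  by rewrite !sqrf_eq0 => /eqP-> /eqP->; rewrite !mul0r oppr0.
set u := Num.sqrt s.
have u0 : 0 < u by rewrite sqrtr_gt0 lt_def sn0.
have u2 : u ^+ 2 = s by rewrite sqr_sqrtr.
(* [sin (acos k)] is never negative, so the sign of [p] has to go into the radius. *)
pose e : R := if 0 <= p then 1 else -1.
have e2 : e ^+ 2 = 1 by rewrite /e; case: ifP; rewrite ?sqrrN expr1n.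
have ep : e * `|p| = p.
  rewrite /e; case: ifPn => [p0|]; first by rewrite mul1r ger0_norm.
  by rewrite -ltNge => p0; rewrite mulN1r ltr0_norm ?opprK.
set k := - (e * q) / u.
have k2 : k ^+ 2 = q ^+ 2 / s by rewrite /k exprMn exprVn u2 sqrrN exprMn e2 mul1r.
have k1 : -1 <= k <= 1.
  rewrite -ler_norml -(@ler_pXn2r _ 2) ?nnegrE// real_normK ?num_real// k2 expr1n.
  by rewrite ler_pdivrMr ?mul1r ?lerDr// lt_def sn0.
exists (acos k); first by rewrite acos_ge0 ?acos_lepi.
exists (e * u).
  rewrite normrM (gtr0_norm u0) -[`|e|]sqrtr_sqr e2 sqrtr1 mul1r//.
rewrite sin_acos// acosK ?in_itv// k2; split.
  have -> : 1 - q ^+ 2 / s = (`|p| / u) ^+ 2.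
    by rewrite exprMn exprVn u2 real_normK ?num_real// /s; field.
  rewrite sqrtr_sqr ger0_norm ?divr_ge0// ?(ltW u0)// -[LHS]ep; field.
  exact: lt0r_neq0.
have -> : e * u * k = - (e ^+ 2 * q) by rewrite /k; field; exact: lt0r_neq0.
by rewrite e2 mul1r opprK.
Qed.

Lemma integral_abs_sinusoid (R : realType) (p q : R) :
  (\int[lebesgue_measure]_(t in `[0%R, pi]) `|p * cos t + q * sin t|%:E =
   (2 * Num.sqrt (p ^+ 2 + q ^+ 2))%:E)%E.
Proof.
have [c c0 [r <- [-> ->]]] := polar_upper_half p q.
transitivity (\int[lebesgue_measure]_(t in `[0%R, pi])
   (`|r|%:E * `|sin (c - t)|%:E))%E.
  apply: eq_integral => t _; rewrite -EFinM -normrM sinB; congr (`| _ |%:E); ring.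
rewrite ge0_integralZl//.
- by rewrite integral_abs_sinB// -EFinM mulrC.
- apply/measurable_EFinP; apply: measurableT_comp => //.
  apply: measurable_funTS; apply: measurableT_comp => //.
    by apply: continuous_measurable_fun; exact: continuous_sin.
  by apply: measurable_funB.
Qed.

Lemma sin_pi6 (R : realType) : sin (pi / 6 : R) = 1 / 2.
Proof.
have pi0 := @pi_gt0 R.
have := cos2Dsin2 (pi / 6 : R); have := sin_pihalf R.
rewrite (_ : pi / 2 = pi / 6 + (pi / 6 + pi / 6)); last by field.
rewrite sinD (sinD (pi / 6) (pi / 6)) (cosD (pi / 6) (pi / 6)).
have : 0 <= sin (pi / 6 : R) by apply: sin_ge0_pi; apply/andP; split; lra.
set s := sin _; set c := cos _ => s0 e sc.
(* The triple-angle formula and sin (pi / 2) = 1 give 4 s^3 - 3 s + 1 = 0, which factors in this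
   way; [0 <= s] rules out the root -1. *)
have : (s + 1) * (2 * s - 1) ^+ 2 = 0.
  have -> : (s + 1) * (2 * s - 1) ^+ 2 = 4 * s * s ^+ 2 - 3 * s + 1 by ring.
  rewrite -[in X in _ + X]e.
  have -> : s * (c * c - s * s) + c * (s * c + c * s) =
    3 * s * c ^+ 2 - s * s ^+ 2 by ring.
  have -> : c ^+ 2 = 1 - s ^+ 2 by rewrite -sc; ring.
  ring.
move/eqP; rewrite mulf_eq0 sqrf_eq0 => /orP[]/eqP; lra.
Qed.

Lemma sin_le_id (R : realType) (x : R) : 0 < x -> sin x <= x.
Proof.
move=> x0; have [|c _] := @MVT _ (@sin R) (@cos R) 0 x x0 (fun _ _ => _).
  by apply: continuous_subspaceT; exact: continuous_sin.
rewrite sin0 !subr0 => ->; rewrite ler_piMl ?(ltW x0)//; exact: cos_le1.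
Qed.

(** This is sin x <= x at x = pi / 6, where the sine is 1 / 2. *)
Lemma pi_ge3 (R : realType) : 3 <= pi :> R.
Proof.
have := @sin_le_id R (pi / 6).
rewrite sin_pi6 divr_gt0 ?pi_gt0// => /(_ isT); lra.
Qed.

(** * Left-invariant measures on matrices *)

Section Haar.
Variables (R : realType) (n : nat) (P : probability (mxM R n) R).
Hypothesis hP : haar_On P.

Lemma measurable_mxentry (i j : 'I_n) :
  measurable_fun setT (fun A : mxM R n => (A : 'M[R]_n) i j).
Proof.
move=> _ Y mY; rewrite setTI; apply: sub_sigma_algebra => /=.
rewrite -bigcup_seq/=; exists (mxvec_index i j) => /=.
  by rewrite mem_index_enum.
exists Y => //; rewrite setTI; apply/seteqP.
by split=> A /=; rewrite mxvecE.
Qed.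

Lemma measurable_fun_mxM d (T : measurableType d) (f : T -> mxM R n) :
  (forall i j : 'I_n, measurable_fun setT (fun t => (f t : 'M[R]_n) i j)) ->
  measurable_fun setT f.
Proof.
move=> mf _ A mA; rewrite setTI.
(* Pulling back commutes with generating a sigma-algebra, so preimages under single coordinates
   suffice. *)
have : preimage_set_system setT f
    (g_sigma_preimage (fun (k : 'I_(n * n)) (A : mxM R n) => mxvec A 0 k)) (f @^-1` A).
  by exists A => //; rewrite setTI.
rewrite -g_sigma_preimage_comp; move: (f @^-1` A); apply: smallest_sub.
  exact: sigma_algebra_measurable.
rewrite -bigcup_seq/=; apply: bigcup_sub => k _ B [Y mY <-].
case/mxvec_indexP: k => i j.
have := mf i j measurableT Y mY; congr (measurable _).
by congr (_ `&` _); apply/seteqP; split=> t /=; rewrite mxvecE.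
Qed.

Lemma measurable_mulmxl (Q : 'M[R]_n) :
  measurable_fun setT (fun A : mxM R n => (Q *m A : mxM R n)).
Proof.
apply: measurable_fun_mxM => i j.
rewrite (_ : (fun _ => _) = fun A : mxM R n => \sum_k Q i k * (A : 'M[R]_n) k j).
  by apply: measurable_sum => k; apply: measurable_funM => //;
    exact: measurable_mxentry.
by apply/funext => A; rewrite mxE.
Qed.

(** By left invariance [P] equals its pushforward under A -> Q A, so this is a change of
    variables. *)
Lemma haar_integralMl (Q : 'M[R]_n) (F : mxM R n -> \bar R) :
  orthogonal_mx Q -> measurable_fun setT F -> (forall A, 0 <= F A)%E ->
  (\int[P]_(A in setT) F (Q *m A : mxM R n) = \int[P]_(A in setT) F A)%E.
Proof.
move=> oQ mF F0; have mQ := measurable_mulmxl Q.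
rewrite -[RHS](@eq_measure_integral _ _ _ setT P
  (pushforward P (fun A : mxM R n => (Q *m A : mxM R n)))).
  by rewrite ge0_integral_pushforward.
by move=> B mB _; case: hP => _ [_]; exact.
Qed.

Lemma haar_ae_orthogonal : {ae P, forall A : mxM R n, orthogonal_mx A}.
Proof.
case: hP => mO [PO _].
exists (~` [set A : mxM R n | orthogonal_mx A]); split => //.
  exact: measurableC.
by rewrite probability_setC// PO subee.
Qed.

End Haar.

(** * Averaging over plane rotations *)

(** The Givens rotation by angle [t] in the plane of two distinct coordinates [i] and [j], as the
    identity plus a combination of matrix units. *)
Definition plane_rot (R : realType) n (i j : 'I_n) (t : R) : 'M[R]_n :=
  1%:M + (cos t - 1) *: (delta_mx i i + delta_mx j j) +
  sin t *: (delta_mx j i - delta_mx i j).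

Lemma delta_mulmxE (R : realType) n (a b : 'I_n) (A : 'M[R]_n) k l :
  (delta_mx a b *m A) k l = (k == a)%:R * A b l.
Proof.
rewrite mxE (bigD1 b)//= !mxE eqxx andbT big1 ?addr0// => c cb.
by rewrite !mxE (negPf cb) andbF mul0r.
Qed.

Lemma plane_rot_mulE (R : realType) n (i j : 'I_n) (t : R) (A : 'M[R]_n) k l :
  i != j -> (plane_rot i j t *m A) k l =
    if k == i then cos t * A i l - sin t * A j l
    else if k == j then sin t * A i l + cos t * A j l else A k l.
Proof.
move=> ij; rewrite /plane_rot !mulmxDl mul1mx -!scalemxAl mulmxBl mulmxDl.
rewrite !(delta_mulmxE, mxE).
have [->|ki] := eqVneq k i; first by rewrite (negPf ij)/=; ring.
by have [->|kj] := eqVneq k j; rewrite /=; ring.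
Qed.

Lemma plane_rot_orthogonal (R : realType) n (i j : 'I_n) (t : R) :
  i != j -> orthogonal_mx (plane_rot i j t).
Proof.
move=> ij; rewrite /orthogonal_mx.
have -> : (plane_rot i j t)^T = plane_rot i j (- t).
  apply/matrixP => k l; rewrite !mxE cosN sinN ![l == _]eq_sym ![k == _]eq_sym.
  rewrite -!mulnb !natrM; ring.
(* The inserted identity factor lets the row formula [plane_rot_mulE] evaluate both rotations. *)
rewrite -[X in _ *m X]mulmx1; apply/matrixP => k l.
rewrite !plane_rot_mulE// cosN sinN !eqxx [j == i]eq_sym (negPf ij).
have cs := cos2Dsin2 t.
have [->|ki] := eqVneq k i.
  by rewrite -[RHS]mul1r -cs; ring.
by have [->|kj] := eqVneq k j; rewrite // -[RHS]mul1r -cs; ring.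
Qed.

(* Rotating by t / 2 turns x y into x y cos t + (x^2 - y^2) / 2 sin t; integrating
   over t in [0, pi] and exchanging the integrals gives the identity. *)
Lemma haar_abs_prod (R : realType) n (P : probability (mxM R n) R)
    (o i j : 'I_n) (g : mxM R n -> R) :
  haar_On P -> i != j -> measurable_fun setT g -> (forall A, 0 <= g A) ->
  (forall t (A : mxM R n), g (plane_rot i j t *m A : mxM R n) = g A) ->
  (\int[P]_(A in setT) (`|(A : 'M[R]_n) i o * (A : 'M[R]_n) j o| * g A)%:E =
   (pi^-1)%:E * \int[P]_(A in setT)
     (((A : 'M[R]_n) i o ^+ 2 + (A : 'M[R]_n) j o ^+ 2) * g A)%:E)%E.
Proof.
move=> hP ij mg g0 gQ.
pose x (A : mxM R n) : R := (A : 'M[R]_n) i o.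
pose y (A : mxM R n) : R := (A : 'M[R]_n) j o.
have mx : measurable_fun setT x by exact: measurable_mxentry.
have my : measurable_fun setT y by exact: measurable_mxentry.
pose p A := x A * y A; pose q A := (x A ^+ 2 - y A ^+ 2) / 2.
have mp : measurable_fun setT p by exact: measurable_funM.
have mq : measurable_fun setT q.
  by apply: measurable_funM => //; apply: measurable_funB; exact: measurable_funX.
set L := LHS.
pose F (A : mxM R n) (t : R) : R := `|p A * cos t + q A * sin t| * g A.
have FL t : (\int[P]_(A in setT) (F A t)%:E = L)%E.
  have oQ := plane_rot_orthogonal (t / 2) ij.
  rewrite /L -(@haar_integralMl _ _ _ hP _ (fun A => (`|p A| * g A)%:E) oQ); last 2 first.
  - apply/measurable_EFinP; apply: measurable_funM => //.
    by apply: measurableT_comp => //; exact: mp.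
  - by move=> A; rewrite lee_fin mulr_ge0.
  apply: eq_integral => A _; rewrite /F gQ; congr (`| _ | * _)%:E.
  rewrite /p /q /x /y !plane_rot_mulE// !eqxx [j == i]eq_sym (negPf ij).
  have -> : cos t = cos (t / 2) * cos (t / 2) - sin (t / 2) * sin (t / 2).
    by rewrite -cosD -splitr.
  have -> : sin t = sin (t / 2) * cos (t / 2) + cos (t / 2) * sin (t / 2).
    by rewrite -sinD -splitr.
  by move: (cos _) (sin _) => c s; field.
pose D : set R := `[0%R, pi]%classic.
(* The indicator of [0, pi] enters the integrand so that Tonelli applies on the whole product
   space. *)
pose G (z : mxM R n * R) : \bar R := (F z.1 z.2 * \1_D z.2)%:E.
have mc : measurable_fun setT (fun z : mxM R n * R => cos z.2).
  apply: measurableT_comp => //.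
  by apply: continuous_measurable_fun; exact: continuous_cos.
have ms : measurable_fun setT (fun z : mxM R n * R => sin z.2).
  apply: measurableT_comp => //.
  by apply: continuous_measurable_fun; exact: continuous_sin.
have mG : measurable_fun setT G.
  apply/measurable_EFinP; apply: measurable_funM.
    apply: measurable_funM; last exact: measurableT_comp.
    apply: measurableT_comp => //.
    by apply: measurable_funD; apply: measurable_funM => //; exact: measurableT_comp.
  by apply: measurableT_comp => //; apply: measurable_indic; exact: measurable_itv.
have G0 z : (0 <= G z)%E.
  by rewrite lee_fin mulr_ge0// mulr_ge0.
have inner A : (\int[lebesgue_measure]_t G (A, t) = ((x A ^+ 2 + y A ^+ 2) * g A)%:E)%E.
  transitivity (\int[lebesgue_measure]_(t in D)
      ((g A)%:E * (`|p A * cos t + q A * sin t| : R)%:E))%E.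
    rewrite [RHS]integral_mkcond epatch_indic; apply: eq_integral => t _.
    by rewrite /G/= /F -!EFinM [in RHS](mulrC (g A)).
  have mD : measurable D by exact: measurable_itv.
  rewrite ge0_integralZl//; last 2 first.
  - apply/measurable_EFinP; apply: measurableT_comp => //.
    apply: measurable_funTS; apply: measurable_funD; apply: measurable_funM => //.
      by apply: continuous_measurable_fun; exact: continuous_cos.
    by apply: continuous_measurable_fun; exact: continuous_sin.
  - by rewrite lee_fin.
  rewrite integral_abs_sinusoid -EFinM; congr EFin.
  (* The amplitude of the sinusoid is half of x^2 + y^2, which cancels the factor 2 of
     [integral_abs_sinusoid]. *)
  have -> : p A ^+ 2 + q A ^+ 2 = ((x A ^+ 2 + y A ^+ 2) / 2) ^+ 2.
    by rewrite /p /q; field.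
  by rewrite sqrtr_sqr ger0_norm ?divr_ge0 ?addr_ge0 ?sqr_ge0//; field.
have := @fubini_tonelli _ _ _ _ R P (@lebesgue_measure R) G mG G0.
under eq_integral do rewrite inner.
move=> ->.
have L0 : (0 <= L)%E by apply: integral_ge0 => A _; rewrite lee_fin mulr_ge0.
clearbody L.
transitivity ((pi^-1)%:E * \int[lebesgue_measure]_(t in D) L)%E.
  rewrite integral_cst; last exact: measurable_itv.
  rewrite [X in (L * X)%E]lebesgue_measure_itv/= lte_fin pi_gt0 oppr0 adde0 muleCA -EFinM.
  by rewrite mulVf ?mule1// gt_eqF// pi_gt0.
congr (_ * _)%E; rewrite integral_mkcond epatch_indic; apply: eq_integral => t _.
rewrite /= -(FL t) muleC -ge0_integralZl//.
- by apply: eq_integral => A _; rewrite /G/= EFinM muleC.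
- apply/measurable_EFinP; apply: measurable_funM => //; apply: measurableT_comp => //.
  by apply: measurable_funD; apply: measurable_funM.
- by move=> A _; rewrite lee_fin mulr_ge0.
Qed.

(** * Sums over pairs and quadruples of indices *)

Section OffDiagonalSums.
Variables (R : realType) (I : finType) (y : I -> R).
Hypothesis y2 : \sum_i y i ^+ 2 = 1.

Lemma sum_pairE (F : I -> I -> R) :
  \sum_(p : I * I) F p.1 p.2 = \sum_i \sum_j F i j.
Proof. by rewrite pair_bigA. Qed.

Lemma sum_diag (F : I -> I -> R) :
  \sum_(p : I * I | p.1 == p.2) F p.1 p.2 = \sum_i F i i.
Proof.
rewrite -(pair_big_dep xpredT (fun i j => i == j))/=; apply: eq_bigr => i _.
by under eq_bigl do rewrite eq_sym; rewrite big_pred1_eq.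
Qed.

Lemma sqr_sumE :
  (\sum_i y i) ^+ 2 = 1 + \sum_(p : I * I | p.1 != p.2) y p.1 * y p.2.
Proof.
rewrite expr2 big_distrlr/= -sum_pairE (bigID (fun p => p.1 == p.2))/=.
by rewrite (sum_diag (fun i j => y i * y j)) -y2.
Qed.

(** All ordered pairs together give 2 |I|, and the diagonal accounts for 2 of it. *)
Lemma sum_offdiag_sqr :
  \sum_(p : I * I | p.1 != p.2) (y p.1 ^+ 2 + y p.2 ^+ 2) = 2 * (#|I|%:R - 1).
Proof.
have : \sum_(p : I * I) (y p.1 ^+ 2 + y p.2 ^+ 2) = 2 * #|I|%:R.
  rewrite (sum_pairE (fun i j => y i ^+ 2 + y j ^+ 2)).
  under eq_bigr do rewrite big_split/= y2 sumr_const.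
  by rewrite big_split/= sumr_const sumrMnl y2; ring.
rewrite (bigID (fun p => p.1 == p.2))/=.
rewrite (sum_diag (fun i j => y i ^+ 2 + y j ^+ 2)) big_split/= y2.
by move=> e; rewrite mulrBr -e; ring.
Qed.

(** Quadruples are kept as pairs of pairs because plane averaging treats one pair at a time;
    distinctness makes a rotation for one pair fix the other pair. *)
Definition distinct4 (q : (I * I) * (I * I)) :=
  [&& q.1.1 != q.1.2, q.2.1 != q.2.2, q.1.1 != q.2.1, q.1.1 != q.2.2,
      q.1.2 != q.2.1 & q.1.2 != q.2.2].

Hypothesis y0 : forall i, 0 <= y i.

(** A union bound over the six possible coincidences among four indices. Each coincidence class sums
    to the square of the sum of the [y i], since the coinciding pair contributes the sum of
    [y i ^+ 2], which is 1. *)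
Lemma expr4_sum_le :
  (\sum_i y i) ^+ 4 <= 6 * (\sum_i y i) ^+ 2 +
    \sum_(q | distinct4 q) y q.1.1 * y q.1.2 * (y q.2.1 * y q.2.2).
Proof.
pose t (q : (I * I) * (I * I)) := y q.1.1 * y q.1.2 * (y q.2.1 * y q.2.2).
have t0 q : 0 <= t q by rewrite !mulr_ge0.
have S2 : (\sum_i y i) ^+ 2 = \sum_(p : I * I) y p.1 * y p.2.
  by rewrite (sum_pairE (fun i j => y i * y j)) expr2 big_distrlr.
have -> : (\sum_i y i) ^+ 4 = \sum_q t q.
  rewrite (_ : 4%N = (2 * 2)%N)// exprM S2 expr2 big_distrlr/=.
  by rewrite (pair_bigA _ (fun p r => y p.1 * y p.2 * (y r.1 * y r.2))).
have W : \sum_q (q.1.1 == q.1.2)%:R * t q = (\sum_i y i) ^+ 2.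
  rewrite -[RHS]mul1r -[in RHS]y2 S2 -(sum_diag (fun i j => y i * y j)).
  rewrite [in RHS]big_mkcond/= [RHS]big_distrlr/= (pair_bigA _ (fun p r =>
    (if p.1 == p.2 then y p.1 * y p.2 else 0) * (y r.1 * y r.2)))/=.
  by apply: eq_bigr => q _; rewrite /t; case: (_ == _); rewrite /= ?mul1r ?mul0r.
(* Permuting the coordinates reduces every diagonal to i = j. *)
have Wh (h : (I * I) * (I * I) -> (I * I) * (I * I)) : involutive h ->
    (forall q, t (h q) = t q) ->
    \sum_q ((h q).1.1 == (h q).1.2)%:R * t q = (\sum_i y i) ^+ 2.
  move=> hK th; rewrite -W [RHS](reindex_inj (inv_inj hK)).
  by apply: eq_bigr => q _; rewrite th.
have W1 := Wh (fun q => ((q.1.1, q.2.1), (q.1.2, q.2.2))).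
have W2 := Wh (fun q => ((q.1.1, q.2.2), (q.2.1, q.1.2))).
have W3 := Wh (fun q => ((q.2.1, q.1.2), (q.1.1, q.2.2))).
have W4 := Wh (fun q => ((q.2.2, q.1.2), (q.2.1, q.1.1))).
have W5 := Wh (fun q => (q.2, q.1)).
have -> : 6 * (\sum_i y i) ^+ 2 =
  \sum_q (((q.1.1 == q.1.2)%:R + (q.1.1 == q.2.1)%:R + (q.1.1 == q.2.2)%:R +
   (q.2.1 == q.1.2)%:R + (q.2.2 == q.1.2)%:R + (q.2.1 == q.2.2)%:R) * t q).
{ under [RHS]eq_bigr do rewrite !mulrDl.
  rewrite !big_split/= W W1 ?W2 ?W3 ?W4 ?W5; first ring.
  all: try (by case=> [[i j] [k l]]).
  all: by case=> [[i j] [k l]]; rewrite /t/=; ring. }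
rewrite [X in _ + X]big_mkcond/= -big_split/=; apply: ler_sum => q _.
rewrite /distinct4 -/(t q) [q.2.1 == q.1.2]eq_sym [q.2.2 == q.1.2]eq_sym.
(* A quadruple with a coincidence has weight at least 1 in the first sum; one without is counted
   once in the second. *)
have := t0 q; do 6 (case: eqP => _ /=); rewrite ?mulr1n ?mulr0n; lra.
Qed.

(** The terms are nonnegative, so the distinctness condition may be dropped; the full sum factors as
    (2 |I|)^2. *)
Lemma sum_distinct4_sqr :
  \sum_(q | distinct4 q)
    (y q.1.1 ^+ 2 + y q.1.2 ^+ 2) * (y q.2.1 ^+ 2 + y q.2.2 ^+ 2) <=
  4 * #|I|%:R ^+ 2.
Proof.
pose s (p : I * I) := y p.1 ^+ 2 + y p.2 ^+ 2.
have s0 p : 0 <= s p by rewrite addr_ge0 ?sqr_ge0.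
have s2 : \sum_p s p = 2 * #|I|%:R.
  rewrite (sum_pairE (fun i j => y i ^+ 2 + y j ^+ 2)).
  under eq_bigr do rewrite big_split/= y2 sumr_const.
  by rewrite big_split/= sumr_const sumrMnl y2; ring.
have -> : 4 * #|I|%:R ^+ 2 = \sum_(q : (I * I) * (I * I)) s q.1 * s q.2.
  by rewrite -(pair_bigA _ (fun p r => s p * s r))/= -big_distrlr/= s2; ring.
by rewrite big_mkcond/=; apply: ler_sum => q _; case: ifP => // _; rewrite mulr_ge0.
Qed.

End OffDiagonalSums.

(** * Moments of the l1 norm of a column *)

Section Moments.
Variables (R : realType) (n : nat) (P : probability (mxM R n) R).
Hypothesis hP : haar_On P.

(** Identities such as the unit norm of a column hold only for orthogonal matrices, hence almost
    everywhere for [P]. *)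
Lemma haar_le_integral (F G : mxM R n -> R) :
  measurable_fun setT F -> measurable_fun setT G ->
  (forall A, 0 <= F A) -> (forall A, 0 <= G A) ->
  (forall A : mxM R n, orthogonal_mx A -> F A <= G A) ->
  (\int[P]_(A in setT) (F A)%:E <= \int[P]_(A in setT) (G A)%:E)%E.
Proof.
move=> mF mG F0 G0 FG; apply: ae_ge0_le_integral => //.
- by move=> A _; rewrite lee_fin.
- exact/measurable_EFinP.
- by move=> A _; rewrite lee_fin.
- exact/measurable_EFinP.
- have [N [mN N0 sub]] := haar_ae_orthogonal hP; exists N; split => //.
  by apply: subset_trans sub => A /=; apply: contra_not => oA _; rewrite lee_fin FG.
Qed.

Lemma haar_eq_integral (F G : mxM R n -> R) :
  measurable_fun setT F -> measurable_fun setT G ->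
  (forall A, 0 <= F A) -> (forall A, 0 <= G A) ->
  (forall A : mxM R n, orthogonal_mx A -> F A = G A) ->
  (\int[P]_(A in setT) (F A)%:E = \int[P]_(A in setT) (G A)%:E)%E.
Proof.
by move=> mF mG F0 G0 FG; apply/eqP; rewrite eq_le; apply/andP; split;
  apply: haar_le_integral => // A /FG ->.
Qed.

(** Applies an averaging identity termwise to a sum over pairs or quadruples; nonnegativity makes
    the exchange of sum and integral valid without integrability. *)
Lemma integral_sum_scale (T : finType) (p : pred T) (F G : T -> mxM R n -> R) (c : R) :
  (forall t, measurable_fun setT (F t)) -> (forall t, measurable_fun setT (G t)) ->
  (forall t A, 0 <= F t A) -> (forall t A, 0 <= G t A) -> 0 <= c ->
  (forall t, p t -> \int[P]_(A in setT) (F t A)%:E =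
                    c%:E * \int[P]_(A in setT) (G t A)%:E)%E ->
  (\int[P]_(A in setT) (\sum_(t | p t) F t A)%:E =
   c%:E * \int[P]_(A in setT) (\sum_(t | p t) G t A)%:E)%E.
Proof.
move=> mF mG F0 G0 c0 FG.
have S (H : T -> mxM R n -> R) : (forall t, measurable_fun setT (H t)) ->
    (forall t A, 0 <= H t A) ->
    (\int[P]_(A in setT) (\sum_(t | p t) H t A)%:E =
     \sum_(t | p t) \int[P]_(A in setT) (H t A)%:E)%E.
  move=> mH H0; rewrite -big_filter -ge0_integral_sum//.
  - by apply: eq_integral => A _; rewrite big_filter sumEFin.
  - by move=> t; exact/measurable_EFinP.
  - by move=> t A _; rewrite lee_fin.
rewrite !S// ge0_sume_distrr; last first.
  by move=> t _; apply: integral_ge0 => A _; rewrite lee_fin.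
exact: eq_bigr.
Qed.

Lemma integral_probability_cst (c : R) : (\int[P]_(A in setT) c%:E = c%:E)%E.
Proof.
transitivity (c%:E * P setT)%E; first exact: integral_cst.
by rewrite probability_setT mule1.
Qed.

Variable o : 'I_n.

Definition entry (i : 'I_n) (A : mxM R n) : R := (A : 'M[R]_n) i o.

Lemma measurable_entry i : measurable_fun setT (entry i).
Proof. exact: measurable_mxentry. Qed.
Hint Resolve measurable_entry : core.

Lemma measurable_abs_entry i : measurable_fun setT (fun A => `|entry i A|).
Proof. by apply: measurableT_comp. Qed.
Hint Resolve measurable_abs_entry : core.

Lemma sum_entry_sqr (A : mxM R n) :
  orthogonal_mx A -> \sum_i `|entry i A| ^+ 2 = 1.
Proof.
move=> /matrixP/(_ o o); rewrite !mxE eqxx mulr1n => <-.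
by apply: eq_bigr => i _; rewrite !mxE real_normK ?num_real// expr2.
Qed.

Definition l1col (A : mxM R n) : R := \sum_i `|entry i A|.

Lemma measurable_l1col : measurable_fun setT l1col.
Proof. exact: measurable_sum. Qed.

Lemma l1col_ge0 A : 0 <= l1col A.
Proof. exact: sumr_ge0. Qed.

Definition absprod (p : 'I_n * 'I_n) (A : mxM R n) : R :=
  `|entry p.1 A| * `|entry p.2 A|.

(** The absolute values are kept so that the finite-sum lemmas apply with [y i] equal to
    [|entry i A|]. *)
Definition sqrsum (p : 'I_n * 'I_n) (A : mxM R n) : R :=
  `|entry p.1 A| ^+ 2 + `|entry p.2 A| ^+ 2.

Lemma measurable_absprod p : measurable_fun setT (absprod p).
Proof. exact: measurable_funM. Qed.

Lemma measurable_sqrsum p : measurable_fun setT (sqrsum p).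
Proof. by apply: measurable_funD; apply: measurable_funX. Qed.
Hint Resolve measurable_absprod measurable_sqrsum : core.

Lemma absprod_ge0 p A : 0 <= absprod p A.
Proof. by rewrite mulr_ge0. Qed.

Lemma sqrsum_ge0 p A : 0 <= sqrsum p A.
Proof. by rewrite addr_ge0 ?sqr_ge0. Qed.
Hint Resolve absprod_ge0 sqrsum_ge0 : core.

Lemma haar_absprod (p : 'I_n * 'I_n) (g : mxM R n -> R) :
  p.1 != p.2 -> measurable_fun setT g -> (forall A, 0 <= g A) ->
  (forall t (A : mxM R n), g (plane_rot p.1 p.2 t *m A : mxM R n) = g A) ->
  (\int[P]_(A in setT) (absprod p A * g A)%:E =
   (pi^-1)%:E * \int[P]_(A in setT) (sqrsum p A * g A)%:E)%E.
Proof.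
move=> pd mg g0 gQ; have := haar_abs_prod o hP pd mg g0 gQ.
under eq_integral do rewrite normrM.
move=> ->; congr (_ * _)%E; apply: eq_integral => A _.
by rewrite /sqrsum !real_normK ?num_real.
Qed.

Lemma entry_plane_rot (i j k : 'I_n) t (A : mxM R n) :
  i != j -> k != i -> k != j -> entry k (plane_rot i j t *m A : mxM R n) = entry k A.
Proof.
by move=> ij ki kj; rewrite /entry plane_rot_mulE// (negPf ki) (negPf kj).
Qed.

Lemma pi_inv_ge0 : 0 <= pi^-1 :> R.
Proof. by rewrite invr_ge0 pi_ge0. Qed.
Hint Resolve pi_inv_ge0 : core.

(** The diagonal of the expanded square gives 1; plane averaging with constant weight turns the rest
    into pi^-1 times the deterministic sum [sum_offdiag_sqr]. *)
Lemma haar_l1col_sqr :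
  (\int[P]_(A in setT) (l1col A ^+ 2)%:E = (1 + 2 * (n%:R - 1) / pi)%:E)%E.
Proof.
have ms (F : 'I_n * 'I_n -> mxM R n -> R) : (forall p, measurable_fun setT (F p)) ->
    measurable_fun setT (fun A => \sum_(p : 'I_n * 'I_n | p.1 != p.2) F p A).
  by move=> mF; under eq_fun do rewrite big_mkcond/=;
    apply: measurable_sum => p; case: (p.1 != p.2).
have s0 (F : 'I_n * 'I_n -> mxM R n -> R) : (forall p A, 0 <= F p A) ->
    forall A, 0 <= \sum_(p : 'I_n * 'I_n | p.1 != p.2) F p A.
  by move=> F0 A; apply: sumr_ge0.
rewrite (@haar_eq_integral _
  (fun A => 1 + \sum_(p : 'I_n * 'I_n | p.1 != p.2) absprod p A)); first last.
- by move=> A /sum_entry_sqr; exact: sqr_sumE.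
- by move=> A; rewrite addr_ge0//; apply: s0.
- by move=> A; rewrite sqr_ge0.
- by apply: measurable_funD => //; exact: ms.
- by apply: measurable_funX; exact: measurable_l1col.
under eq_integral do rewrite EFinD.
rewrite ge0_integralD//; first last.
- by apply/measurable_EFinP; exact: ms.
- by move=> A _; rewrite lee_fin; apply: s0.
rewrite integral_probability_cst.
rewrite (@integral_sum_scale _ _ _ sqrsum pi^-1)//; last first.
  move=> p pd; have := @haar_absprod p (cst 1) pd.
  under eq_integral do rewrite mulr1.
  by under [in X in (_ * X)%E]eq_integral do rewrite mulr1; apply.
rewrite (@haar_eq_integral _ (cst (2 * (n%:R - 1)))) //; first last.
- by move=> A /sum_entry_sqr/sum_offdiag_sqr; rewrite card_ord.
- move=> A; rewrite mulr_ge0// subr_ge0 ler1n; exact: leq_ltn_trans (ltn_ord o).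
- exact: s0.
- exact: ms.
rewrite integral_probability_cst -EFinM -EFinD; congr EFin; ring.
Qed.

(** Coincident indices cost at most six second moments. On distinct quadruples plane averaging is
    used twice, once per pair, with the other pair as invariant weight; each use gives a factor
    pi^-1. *)
Lemma haar_l1col_exp4 :
  (\int[P]_(A in setT) (l1col A ^+ 4)%:E <=
   (6 * (1 + 2 * (n%:R - 1) / pi) + 4 * n%:R ^+ 2 / pi ^+ 2)%:E)%E.
Proof.
pose T := (('I_n * 'I_n) * ('I_n * 'I_n))%type.
have ms (F : T -> mxM R n -> R) : (forall p, measurable_fun setT (F p)) ->
    measurable_fun setT (fun A => \sum_(q | distinct4 q) F q A).
  by move=> mF; under eq_fun do rewrite big_mkcond/=;
    apply: measurable_sum => p; case: (distinct4 p).
have s0 (F : T -> mxM R n -> R) : (forall p A, 0 <= F p A) ->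
    forall A, 0 <= \sum_(q | distinct4 q) F q A.
  by move=> F0 A; apply: sumr_ge0.
have ml2 : measurable_fun setT (fun A => l1col A ^+ 2).
  by apply: measurable_funX; exact: measurable_l1col.
apply: (@le_trans _ _ (\int[P]_(A in setT) (6 * l1col A ^+ 2 +
    \sum_(q | distinct4 q) absprod q.1 A * absprod q.2 A)%:E)%E).
  apply: haar_le_integral.
  - by apply: measurable_funX; exact: measurable_l1col.
  - apply: measurable_funD; first exact: measurable_funM.
    by apply: ms => q; exact: measurable_funM.
  - by move=> A; rewrite exprn_ge0// l1col_ge0.
  - move=> A; rewrite addr_ge0//; first by rewrite mulr_ge0 ?sqr_ge0.
    by apply: (s0 (fun q A => absprod q.1 A * absprod q.2 A)) => q B; rewrite mulr_ge0.
  - by move=> A /sum_entry_sqr s1; apply: expr4_sum_le.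
under eq_integral do rewrite EFinD.
rewrite ge0_integralD//; first last.
- by apply/measurable_EFinP; apply: ms => q; exact: measurable_funM.
- move=> A _; rewrite lee_fin.
  by apply: (s0 (fun q A => absprod q.1 A * absprod q.2 A)) => q B; rewrite mulr_ge0.
- by apply/measurable_EFinP; exact: measurable_funM.
- by move=> A _; rewrite lee_fin mulr_ge0// sqr_ge0.
under eq_integral do rewrite EFinM.
rewrite ge0_integralZl//; last 2 first.
- exact/measurable_EFinP.
- by move=> A _; rewrite lee_fin sqr_ge0.
rewrite haar_l1col_sqr -EFinM [leRHS]EFinD leeD2l//.
rewrite (@integral_sum_scale _ _ _ (fun q A => sqrsum q.1 A * absprod q.2 A) pi^-1)//;
  last first.
- move=> q /and5P[q1 q2 n1 n2 /andP[n3 n4]]; apply: haar_absprod => // t A.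
  by rewrite /absprod !entry_plane_rot// eq_sym.
- by move=> q A; rewrite mulr_ge0.
- by move=> q A; rewrite mulr_ge0.
- by move=> q; exact: measurable_funM.
- by move=> q; exact: measurable_funM.
rewrite (@integral_sum_scale _ _ _ (fun q A => sqrsum q.1 A * sqrsum q.2 A) pi^-1)//;
  last first.
- move=> q /and5P[q1 q2 n1 n2 /andP[n3 n4]].
  (* The product is swapped so that the second pair is averaged and [sqrsum] of the first pair
     serves as weight. *)
  under eq_integral do rewrite mulrC.
  rewrite haar_absprod//; first by congr (_ * _)%E; apply: eq_integral => A _; rewrite mulrC.
  by move=> t A; rewrite /sqrsum !entry_plane_rot.
- by move=> q A; rewrite mulr_ge0.
- by move=> q A; rewrite mulr_ge0.
- by move=> q; exact: measurable_funM.
- by move=> q; exact: measurable_funM.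
apply: (@le_trans _ _ ((pi^-1)%:E * ((pi^-1)%:E * (4 * n%:R ^+ 2)%:E))%E).
  rewrite lee_pmul// ?lee_fin//.
  - rewrite mule_ge0 ?lee_fin// integral_ge0// => A _; rewrite lee_fin.
    by apply: (s0 (fun q A => sqrsum q.1 A * sqrsum q.2 A)) => q B; rewrite mulr_ge0.
  rewrite lee_pmul// ?lee_fin//.
  - rewrite integral_ge0// => A _; rewrite lee_fin.
    by apply: (s0 (fun q A => sqrsum q.1 A * sqrsum q.2 A)) => q B; rewrite mulr_ge0.
  apply: (@le_trans _ _ (\int[P]_(A in setT) (cst (4 * n%:R ^+ 2) A)%:E)%E).
    apply: haar_le_integral => //.
    - by apply: ms => q; exact: measurable_funM.
    - by apply: (s0 (fun q A => sqrsum q.1 A * sqrsum q.2 A)) => q A; rewrite mulr_ge0.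
    - by move=> A; rewrite mulr_ge0// sqr_ge0.
    - by move=> A /sum_entry_sqr/sum_distinct4_sqr; rewrite card_ord.
  by rewrite integral_probability_cst.
rewrite -!EFinM lee_fin le_eqVlt; apply/orP; left; apply/eqP.
by rewrite -exprVn; ring.
Qed.

End Moments.

(** * The distance to the rotated cube *)

Section Enorm.
Variable R : realType.

(** Lagrange's identity: the defect is half of the double sum of (x_i y_j - x_j y_i)^2. *)
Lemma cauchy_schwarz_sum (I : finType) (x y : I -> R) :
  (\sum_i x i * y i) ^+ 2 <= (\sum_i x i ^+ 2) * (\sum_i y i ^+ 2).
Proof.
have : 0 <= \sum_i \sum_j (x i * y j - x j * y i) ^+ 2.
  by do 2 (apply: sumr_ge0 => ? _); rewrite sqr_ge0.
have -> : \sum_i \sum_j (x i * y j - x j * y i) ^+ 2 =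
   2 * ((\sum_i x i ^+ 2) * (\sum_i y i ^+ 2) - (\sum_i x i * y i) ^+ 2).
  have -> : \sum_i \sum_j (x i * y j - x j * y i) ^+ 2 =
    \sum_i \sum_j (x i ^+ 2 * y j ^+ 2) + \sum_i \sum_j (y i ^+ 2 * x j ^+ 2) -
    2 * \sum_i \sum_j ((x i * y i) * (x j * y j)).
    rewrite mulr_sumr -sumrN -!big_split/=; apply: eq_bigr => i _.
    rewrite mulr_sumr -sumrN -!big_split/=; apply: eq_bigr => j _; ring.
  by rewrite -!big_distrlr/=; ring.
by rewrite pmulr_rge0// subr_ge0.
Qed.

Lemma enorm_ge0 n (x : 'cV[R]_n) : 0 <= enorm x.
Proof. exact: sqrtr_ge0. Qed.

Lemma enorm_sqr n (x : 'cV[R]_n) : enorm x ^+ 2 = \sum_i x i 0 ^+ 2.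
Proof. by rewrite sqr_sqrtr// sumr_ge0// => i _; rewrite sqr_ge0. Qed.

Lemma enormD n (x y : 'cV[R]_n) : enorm (x + y) <= enorm x + enorm y.
Proof.
rewrite -(@ler_pXn2r _ 2) ?nnegrE ?addr_ge0 ?enorm_ge0//.
rewrite sqrrD !enorm_sqr.
have -> : \sum_i (x + y) i 0 ^+ 2 = \sum_i x i 0 ^+ 2 +
    (\sum_i x i 0 * y i 0) *+ 2 + \sum_i y i 0 ^+ 2.
  by rewrite -sumrMnl -!big_split/=; apply: eq_bigr => i _; rewrite mxE sqrrD.
rewrite lerD2r lerD2l lerMn2r/= (le_trans (ler_norm _))//.
rewrite -(@ler_pXn2r _ 2) ?nnegrE ?mulr_ge0 ?enorm_ge0//.
by rewrite real_normK ?num_real// exprMn !enorm_sqr; exact: cauchy_schwarz_sum.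
Qed.

Lemma enormN n (x : 'cV[R]_n) : enorm (- x) = enorm x.
Proof.
by rewrite /enorm; congr Num.sqrt; apply: eq_bigr => i _; rewrite mxE sqrrN.
Qed.

Lemma enorm0 n : enorm (0 : 'cV[R]_n) = 0.
Proof.
by rewrite /enorm big1 ?sqrtr0// => i _; rewrite mxE expr0n.
Qed.

Lemma enorm_orthogonal n (Q : 'M[R]_n) (x : 'cV[R]_n) :
  orthogonal_mx Q -> enorm (Q *m x) = enorm x.
Proof.
move=> oQ; have E (z : 'cV[R]_n) : \sum_i z i 0 ^+ 2 = (z^T *m z) 0 0.
  by rewrite mxE; apply: eq_bigr => i _; rewrite mxE expr2.
by rewrite /enorm !E trmx_mul mulmxA -(mulmxA _ Q^T) oQ mulmx1.
Qed.

(* The default value of the iterated minimum is one of its terms, so it is neutral. *)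
Definition mindist n (T : finType) (t0 : T) (c : T -> 'cV[R]_n) (x : 'cV[R]_n) : R :=
  \big[Num.min/enorm (x - c t0)]_t enorm (x - c t).

Section Mindist.
Variables (n : nat) (T : finType) (t0 : T) (c : T -> 'cV[R]_n).

Lemma mindist_le t x : mindist t0 c x <= enorm (x - c t).
Proof. exact: bigmin_le. Qed.

Lemma le_mindist z x : (forall t, z <= enorm (x - c t)) -> z <= mindist t0 c x.
Proof. by move=> h; apply/bigmin_geP; split. Qed.

Lemma mindist_ge0 x : 0 <= mindist t0 c x.
Proof. by apply: le_mindist => t; exact: enorm_ge0. Qed.

Lemma mindist_center t : mindist t0 c (c t) = 0.
Proof.
apply/eqP; rewrite eq_le mindist_ge0 andbT.
by rewrite (le_trans (mindist_le t _))// subrr enorm0.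
Qed.

Lemma mindist_lip1 : lip1 (mindist t0 c).
Proof.
have h x y : mindist t0 c x <= mindist t0 c y + enorm (x - y).
  rewrite -lerBlDr; apply: le_mindist => t; rewrite lerBlDr.
  rewrite (le_trans (mindist_le t _))// [leRHS]addrC.
  by rewrite (_ : x - c t = (x - y) + (y - c t)) ?enormD// addrA subrK.
move=> x y; have h1 := h x y; have := h y x.
rewrite -(enormN (y - x)) opprB => h2; rewrite ler_norml; apply/andP; split; lra.
Qed.

Lemma measurable_mindist (u : 'cV[R]_n) :
  measurable_fun setT (fun A : mxM R n => mindist t0 c ((A : 'M[R]_n) *m u)).
Proof.
have me t : measurable_fun setT (fun A : mxM R n => enorm ((A : 'M[R]_n) *m u - c t)).
  apply: (@measurableT_comp _ _ _ _ _ _ (@Num.sqrt R)).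
    by apply: continuous_measurable_fun; exact: sqrt_continuous.
  apply: measurable_sum => i; apply: measurable_funX.
  under eq_fun do rewrite !mxE; apply: measurable_funB => //.
  apply: measurable_sum => k; apply: measurable_funM => //.
  exact: measurable_mxentry.
(* Induction on the enumeration; the default distance to [c t0] is the base case. *)
rewrite /mindist; elim: (index_enum T) => [|t r ih].
  by under eq_fun do rewrite big_nil; exact: me.
by under eq_fun do rewrite big_cons; exact: measurable_minr.
Qed.

End Mindist.
End Enorm.

(** * The Walsh-Hadamard matrix and the image of the first basis vector *)

Section Hadamard.
Variable R : realType.

Definition ord0_pow2 m : 'I_(2 ^ m) := Ordinal (expn_gt0 2 m : (0 < 2 ^ m)%N).

Lemma castmx_gram n n' (e : n = n') (A : 'M[R]_n) (k : R) :
  A^T *m A = k%:M -> (castmx (e, e) A)^T *m castmx (e, e) A = k%:M.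
Proof. by case: n' / e; rewrite castmx_id. Qed.

Lemma hadamard_gram m : (hadamard R m)^T *m hadamard R m = (2 ^ m)%:R%:M.
Proof.
elim: m => [|m ih]; first by rewrite [hadamard R 0]/= trmx1 mulmx1.
apply: castmx_gram; rewrite tr_block_mx mulmx_block [(- _)^T]raddfN/=.
rewrite !(mulmxN, mulNmx) opprK ih.
have -> : (2 ^ m)%:R%:M + (2 ^ m)%:R%:M = (2 ^ m.+1)%:R%:M :> 'M[R]_(2 ^ m).
  by rewrite -raddfD/= -natrD addnn -mul2n -expnS.
by rewrite !subrr -scalar_mx_block.
Qed.

Lemma hadamard_col0 m k : hadamard R m k (ord0_pow2 m) = 1.
Proof.
elim: m k => [|m ih] k; first by rewrite mxE (ord1 k) (ord1 (ord0_pow2 0)).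
rewrite castmxE/=.
have -> : cast_ord (esym (pow2S_eq m)) (ord0_pow2 m.+1) =
    lshift (2 ^ m) (ord0_pow2 m) by apply: val_inj.
case: (split_ordP (cast_ord (esym (pow2S_eq m)) k)) => j ->; rewrite ?block_mxEul ?block_mxEdl;
  exact: ih.
Qed.

Definition sgnvec n (s : {ffun 'I_n -> bool}) : 'cV[R]_n := \col_i (-1) ^+ s i.

(** This is the orthogonal matrix H / sqrt d applied to the vertex s / sqrt d of the cube inscribed
    in the unit sphere. *)
Definition rotated_cube m (s : {ffun 'I_(2 ^ m) -> bool}) : 'cV[R]_(2 ^ m) :=
  ((2 ^ m)%:R)^-1 *: (hadamard R m *m sgnvec s).

(** The second diagonal only multiplies e_0 by a sign, H sends e_0 to the all-ones vector, and the
    first diagonal turns that into a sign vector, which absorbs the earlier sign. *)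
Lemma Tmap_e0 m (s1 s2 : {ffun 'I_(2 ^ m) -> bool}) :
  Tmap s1 s2 (delta_mx (ord0_pow2 m) 0) =
  rotated_cube [ffun i => s1 i (+) s2 (ord0_pow2 m)] :> 'cV[R]_(2 ^ m).
Proof.
rewrite /Tmap /rotated_cube -!mulmxA; congr (_ *: (_ *m _)).
have -> : sign_diag R s2 *m delta_mx (ord0_pow2 m) 0 =
    (-1) ^+ s2 (ord0_pow2 m) *: delta_mx (ord0_pow2 m) 0 :> 'cV[R]_(2 ^ m).
  apply/matrixP => i j; rewrite /sign_diag mul_diag_mx !mxE.
  by case: eqVneq => [->|]//=; rewrite !mulr0.
rewrite -scalemxAr -colE; apply/matrixP => i j.
by rewrite /sign_diag mul_diag_mx !mxE hadamard_col0 ffunE mulr1 -signr_addb.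
Qed.

Definition cubedist m : 'cV[R]_(2 ^ m) -> R :=
  mindist [ffun=> false] (@rotated_cube m).

Lemma ET_cubedist m : ET (@cubedist m) (delta_mx (ord0_pow2 m) 0) = 0.
Proof.
rewrite /ET big1 ?mulr0// => s1 _; rewrite big1// => s2 _.
by rewrite Tmap_e0 /cubedist mindist_center.
Qed.

Lemma normalized_hadamard_orthogonal m :
  orthogonal_mx ((Num.sqrt (2 ^ m)%:R)^-1 *: hadamard R m).
Proof.
rewrite /orthogonal_mx [(_ *: _)^T]linearZ/= -scalemxAl -scalemxAr hadamard_gram scalerA.
rewrite -invfM -expr2 sqr_sqrtr ?ler0n// scale_scalar_mx mulVf//.
Qed.

(** The nearest vertex copies the signs of the column, so each coordinate contributes at least
    (|x_i| - n^(-1/2))^2; these sum to the left side because the column has unit norm. *)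
Lemma cube_dist_ge n (s : {ffun 'I_n -> bool}) (A : 'M[R]_n) (o : 'I_n) :
  orthogonal_mx A -> (0 < n)%N ->
  2 - 2 * (l1col o A / Num.sqrt n%:R) <=
  enorm (A *m delta_mx o 0 - (Num.sqrt n%:R)^-1 *: sgnvec s) ^+ 2.
Proof.
move=> oA n0; have s1 := sum_entry_sqr o oA.
set w := Num.sqrt n%:R.
have w0 : 0 < w by rewrite sqrtr_gt0 ltr0n.
rewrite enorm_sqr.
have -> : 2 - 2 * (l1col o A / w) =
    \sum_i (`|entry o i A| - w^-1) ^+ 2.
  under eq_bigr do rewrite sqrrB.
  rewrite big_split/= sumrB s1 sumrMnl -mulr_suml -/(l1col o A).
  rewrite sumr_const card_ord exprVn sqr_sqrtr ?ler0n//.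
  have -> : n%:R^-1 *+ n = 1 :> R.
    by rewrite -[LHS]mulr_natl mulfV// pnatr_eq0 -lt0n.
  by ring.
apply: ler_sum => i _; rewrite -colE !mxE -/(entry o i A).
set x := entry o i A; set e := (-1) ^+ s i.
have e2 : e ^+ 2 = 1 by rewrite /e sqrr_sign.
have xe : x * e <= `|x|.
  by rewrite (le_trans (ler_norm _))// normrM /e normr_sign mulr1.
have r0 : 0 <= w^-1 by rewrite invr_ge0 ltW.
rewrite sqrrB [leRHS]sqrrB exprMn e2 mulr1 real_normK ?num_real//.
rewrite lerD2r lerD2l lerN2 lerMn2r/= mulrCA [leRHS]mulrC.
by rewrite ler_wpM2l// mulrC.
Qed.

Lemma l1col_le_sqrt n (A : 'M[R]_n) (o : 'I_n) :
  orthogonal_mx A -> l1col o A <= Num.sqrt n%:R.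
Proof.
move=> oA; have s1 := sum_entry_sqr o oA.
rewrite -(@ler_pXn2r _ 2) ?nnegrE ?sqrtr_ge0 ?l1col_ge0//.
rewrite sqr_sqrtr ?ler0n//.
have := cauchy_schwarz_sum (fun i => `|entry o i A|) (fun=> 1).
under eq_bigr do rewrite mulr1.
by rewrite s1 mul1r expr1n sumr_const card_ord.
Qed.

End Hadamard.

(** * Numerical bounds and conclusion *)

(* t (t - c)^2 (t + 2 c) >= 0. *)
Lemma tangent_quartic (R : realType) (c t : R) : 0 <= c -> 0 <= t ->
  3 * c ^+ 2 * t ^+ 2 - t ^+ 4 <= 2 * c ^+ 3 * t.
Proof.
move=> c0 t0; rewrite -subr_ge0.
have -> : 2 * c ^+ 3 * t - (3 * c ^+ 2 * t ^+ 2 - t ^+ 4) =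
  t * (t - c) ^+ 2 * (t + 2 * c) by ring.
by apply: mulr_ge0; [apply: mulr_ge0 => //; exact: sqr_ge0|lra].
Qed.

(* For D = sqrt (2 - 2 z) both sides agree at z = b. *)
Lemma dist_quartic_minorant (R : realType) (a b z D : R) :
  0 < a -> 1 / 3 <= b -> a ^+ 2 = 2 - 2 * b -> 0 <= z -> z <= 1 ->
  Num.sqrt (2 - 2 * z) <= D ->
  (7 - 3 / b) * z ^+ 2 <= a ^+ 3 * D + (3 * b - 1) / b ^+ 3 * z ^+ 4 + (6 * b - 4).
Proof.
move=> a0 b13 a2 z0 z1; set t := Num.sqrt _ => tD.
have b0 : 0 < b by lra.
have t2 : t ^+ 2 = 2 - 2 * z by rewrite sqr_sqrtr//; lra.
have h1 := tangent_quartic (ltW a0) (sqrtr_ge0 (2 - 2 * z)); rewrite -/t in h1.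
have h2 := tangent_quartic (ltW b0) z0.
have h3 : a ^+ 3 * t <= a ^+ 3 * D by rewrite ler_wpM2l// exprn_ge0// ltW.
have t4 : t ^+ 4 = (2 - 2 * z) ^+ 2 by rewrite -t2 -exprM.
(* The tangent inequality at [c = a], applied to [t], replaces the square root by a quadratic in
   [z]. *)
have h4 : 4 - 6 * b + (6 * b - 2) * z - 2 * z ^+ 2 <= a ^+ 3 * t.
  have : 3 * (2 - 2 * b) * (2 - 2 * z) - (2 - 2 * z) ^+ 2 <= 2 * (a ^+ 3 * t).
    by rewrite -a2 -t4 -t2 mulrA.
  have -> : 3 * (2 - 2 * b) * (2 - 2 * z) - (2 - 2 * z) ^+ 2 =
    2 * (4 - 6 * b + (6 * b - 2) * z - 2 * z ^+ 2) by ring.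
  by rewrite ler_pM2l.
(* The tangent inequality at [c = b] trades the linear term for even powers of [z]; the assumption 1
   / 3 <= b makes its coefficient nonnegative. *)
have h5 : (9 - 3 / b) * z ^+ 2 - (3 * b - 1) / b ^+ 3 * z ^+ 4 <= (6 * b - 2) * z.
  have -> : (9 - 3 / b) * z ^+ 2 - (3 * b - 1) / b ^+ 3 * z ^+ 4 =
    (3 * b - 1) / b ^+ 3 * (3 * b ^+ 2 * z ^+ 2 - z ^+ 4).
    by field; exact: lt0r_neq0.
  have -> : (6 * b - 2) * z = (3 * b - 1) / b ^+ 3 * (2 * b ^+ 3 * z).
    by field; exact: lt0r_neq0.
  by rewrite ler_wpM2l// divr_ge0 ?exprn_ge0 ?(ltW b0)//; lra.
lra.
Qed.

(** * Numerical estimates for the limit constants *)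

Section Constants.
Variable R : realType.

(* The limits of |X|_1 / sqrt d and of the distance from X to the rotated cube. *)
Definition l1_limit : R := Num.sqrt (2 / pi).
Definition dist_limit : R := Num.sqrt (2 * (1 - l1_limit)).

Lemma l1_limit_sqr : l1_limit ^+ 2 = 2 / pi.
Proof. by rewrite sqr_sqrtr// divr_ge0// pi_ge0. Qed.

Lemma two_div_pi_bounds : 1 / 2 <= (2 / pi : R) <= 2 / 3.
Proof.
have p3 := pi_ge3 R; have p4 := pihalf_lt2 R; have p0 := pi_gt0 R.
apply/andP; split.
  by rewrite ler_pdivlMr//; lra.
by rewrite ler_pdivrMr//; lra.
Qed.

Lemma l1_limit_bounds : 7 / 10 <= l1_limit <= 817 / 1000.
Proof.
have /andP[l u] := two_div_pi_bounds.
have b0 : 0 <= l1_limit by exact: sqrtr_ge0.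
have b2 := l1_limit_sqr.
(* Here 0.7^2 = 0.49 <= 1 / 2 and 0.817^2 = 0.667489 >= 2 / 3. *)
apply/andP; split; rewrite -(@ler_pXn2r _ 2 isT) ?nnegrE ?b2; lra.
Qed.

Lemma dist_limit_sqr : dist_limit ^+ 2 = 2 - 2 * l1_limit.
Proof.
have /andP[_ u] := l1_limit_bounds.
by rewrite sqr_sqrtr; lra.
Qed.

Lemma dist_limit_ge : 604 / 1000 <= dist_limit.
Proof.
have /andP[_ u] := l1_limit_bounds; have a2 := dist_limit_sqr.
have a0 : 0 <= dist_limit by exact: sqrtr_ge0.
rewrite -(@ler_pXn2r _ 2 isT) ?nnegrE ?a2; lra.
Qed.

(** Bounds by 13 the coefficient of Z^4 in the minorant of the distance; with the fourth-moment
    error 5 / d this produces the 65 / d of the final estimate. *)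
Lemma tangent_slope_le : 3 * l1_limit - 1 <= 13 * (dist_limit ^+ 3 * l1_limit ^+ 3).
Proof.
have /andP[l u] := l1_limit_bounds; have a2 := dist_limit_sqr; have ag := dist_limit_ge.
have a0 : 0 <= dist_limit by exact: sqrtr_ge0.
have ab2 : (49 / 100) ^+ 2 <= (dist_limit * l1_limit) ^+ 2.
  rewrite [leRHS]exprMn a2; set b := l1_limit in l u *.
  have : 0 <= (b - 7 / 10) * (817 / 1000 - b) by rewrite mulr_ge0; lra.
  nra.
have ab : 49 / 100 <= dist_limit * l1_limit.
  rewrite -(@ler_pXn2r _ 2 isT) ?nnegrE; [exact: ab2|lra|apply: mulr_ge0; lra].
rewrite -exprMn; have : (49 / 100) ^+ 3 <= (dist_limit * l1_limit) ^+ 3.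
  rewrite (@ler_pXn2r _ 3 isT) ?nnegrE; lra.
lra.
Qed.

End Constants.

(** * Integrating the minorant and bounding the Wasserstein distance *)

Section LowerBound.
Variables (R : realType) (m : nat) (P : probability (mxM R (2 ^ m)) R).
Hypotheses (hP : haar_On P) (m0 : (0 < m)%N).
Let e0 : 'cV[R]_(2 ^ m) := delta_mx (ord0_pow2 m) 0.
Let d : R := (2 ^ m)%:R.
Let a := dist_limit R.
Let b := l1_limit R.

(** Rotating [A] by H / sqrt d undoes the rotation of the cube, so [cube_dist_ge] applies to every
    vertex. *)
Lemma cubedist_rotated_ge (A : 'M[R]_(2 ^ m)) : orthogonal_mx A ->
  Num.sqrt (2 - 2 * (l1col (ord0_pow2 m) A / Num.sqrt d)) <=
  cubedist (((Num.sqrt d)^-1 *: hadamard R m) *m A *m e0).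
Proof.
move=> oA; apply: le_mindist => s.
have -> : (Num.sqrt d)^-1 *: hadamard R m *m A *m e0 - rotated_cube R s =
    ((Num.sqrt d)^-1 *: hadamard R m) *m (A *m e0 - (Num.sqrt d)^-1 *: sgnvec R s).
  rewrite mulmxBr mulmxA; congr (_ - _).
  rewrite -scalemxAl -scalemxAr scalerA -invfM -expr2 sqr_sqrtr ?ler0n//.
rewrite enorm_orthogonal; last exact: normalized_hadamard_orthogonal.
rewrite -[leRHS](ger0_norm (enorm_ge0 _)) -sqrtr_sqr ler_wsqrtr//.
by apply: cube_dist_ge => //; rewrite expn_gt0.
Qed.

(** The pointwise minorant is arranged with nonnegative terms on both sides (6 b - 4 >= 0 as b >= 7
    / 10), so it integrates without any integrability argument. *)
Lemma EX_cubedist_ge : ((a - 65 / d)%:E <= EX P (@cubedist R m) e0)%E.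
Proof.
have d0 : 0 < d by rewrite ltr0n expn_gt0.
have d2 : 2 <= d by rewrite ler_nat -[X in (X <= _)%N]expn1 leq_exp2l.
have /andP[bl bu] := l1_limit_bounds R; rewrite -/b in bl bu.
have b0 : 0 < b by lra.
have a0 : 0 < a by have := dist_limit_ge R; rewrite -/a; lra.
have a2 : a ^+ 2 = 2 - 2 * b := dist_limit_sqr R.
have w0 : 0 < Num.sqrt d by rewrite sqrtr_gt0.
have w2 : Num.sqrt d ^+ 2 = d by rewrite sqr_sqrtr// ltW.
pose o := ord0_pow2 m.
pose Y := (Num.sqrt d)^-1 *: hadamard R m.
pose D (A : mxM R (2 ^ m)) : R := cubedist ((Y *m A) *m e0).
have mD : measurable_fun setT D.
  by apply: (measurableT_comp (measurable_mindist _ _ e0) (measurable_mulmxl Y)).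
have D0 A : 0 <= D A by exact: mindist_ge0.
have ml : measurable_fun setT (l1col o : mxM R (2 ^ m) -> R) by exact: measurable_l1col.
have -> : EX P (@cubedist R m) e0 = (\int[P]_(A in setT) (D A)%:E)%E.
  rewrite /EX /D -(@haar_integralMl _ _ _ hP Y
     (fun A => (cubedist ((A : 'M[R]_(2 ^ m)) *m e0))%:E))//.
  - exact: normalized_hadamard_orthogonal.
  - by apply/measurable_EFinP; exact: measurable_mindist.
  - by move=> A; rewrite lee_fin; exact: mindist_ge0.
(* Coefficients of [dist_quartic_minorant] with the powers of sqrt d from Z = |X|_1 / sqrt d
   absorbed. *)
pose c2 := (7 - 3 / b) / d; pose c4 := (3 * b - 1) / b ^+ 3 / d ^+ 2.
have c20 : 0 <= c2.
  rewrite divr_ge0 ?(ltW d0)// subr_ge0 ler_pdivrMr//; lra.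
have c40 : 0 <= c4.
  by rewrite !divr_ge0 ?exprn_ge0 ?(ltW d0) ?(ltW b0)//; lra.
have a30 : 0 <= a ^+ 3 by rewrite exprn_ge0// ltW.
have pt (A : mxM R (2 ^ m)) : orthogonal_mx A ->
    c2 * l1col o A ^+ 2 <= a ^+ 3 * D A + (c4 * l1col o A ^+ 4 + (6 * b - 4)).
  move=> oA; pose z := l1col o A / Num.sqrt d.
  have z0 : 0 <= z by rewrite divr_ge0 ?l1col_ge0// ltW.
  have z1 : z <= 1 by rewrite ler_pdivrMr// mul1r l1col_le_sqrt.
  have b13 : 1 / 3 <= b by lra.
  have := dist_quartic_minorant a0 b13 a2 z0 z1 (cubedist_rotated_ge oA).
  have -> : z ^+ 4 = l1col o A ^+ 4 / d ^+ 2.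
    by rewrite expr_div_n -[in RHS]w2 -exprM.
  rewrite expr_div_n w2 /c2 /c4 -/(D A); lra.
have : (\int[P]_(A in setT) (c2 * l1col o A ^+ 2)%:E <=
  \int[P]_(A in setT) (a ^+ 3 * D A + (c4 * l1col o A ^+ 4 + (6 * b - 4)))%:E)%E.
  apply: haar_le_integral => //.
  - by apply: measurable_funM => //; apply: measurable_funX.
  - apply: measurable_funD; first exact: measurable_funM.
    by apply: measurable_funD => //; apply: measurable_funM => //; apply: measurable_funX.
  - by move=> A; rewrite mulr_ge0 ?sqr_ge0.
  - move=> A; apply: addr_ge0; [exact: mulr_ge0|apply: addr_ge0; last lra].
    by apply: mulr_ge0 => //; rewrite exprn_ge0 ?l1col_ge0.
under eq_integral do rewrite EFinM.
rewrite ge0_integralZl_EFin//; first last.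
- by apply/measurable_EFinP; exact: measurable_funX.
- by move=> A _; rewrite lee_fin sqr_ge0.
under [X in (_ <= X)%E]eq_integral do rewrite EFinD EFinD.
rewrite ge0_integralD//; first last.
- apply/measurable_EFinP; apply: measurable_funD => //.
  by apply: measurable_funM => //; apply: measurable_funX.
- move=> A _; rewrite lee_fin; apply: addr_ge0; last lra.
  by apply: mulr_ge0 => //; rewrite exprn_ge0 ?l1col_ge0.
- by apply/measurable_EFinP; exact: measurable_funM.
- by move=> A _; rewrite lee_fin mulr_ge0.
rewrite ge0_integralD//; first last.
- by move=> A _; rewrite lee_fin; lra.
- by apply/measurable_EFinP; apply: measurable_funM => //; apply: measurable_funX.
- by move=> A _; rewrite lee_fin; apply: mulr_ge0 => //; rewrite exprn_ge0 ?l1col_ge0.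
rewrite integral_probability_cst.
under [X in (_ <= X + _)%E]eq_integral do rewrite EFinM.
rewrite ge0_integralZl_EFin//; first last.
- exact/measurable_EFinP.
- by move=> A _; rewrite lee_fin.
under [X in (_ <= _ + (X + _))%E]eq_integral do rewrite EFinM.
rewrite ge0_integralZl_EFin//; first last.
- by apply/measurable_EFinP; exact: measurable_funX.
- by move=> A _; rewrite lee_fin exprn_ge0 ?l1col_ge0.
rewrite haar_l1col_sqr// -/d.
have := haar_l1col_exp4 hP o; rewrite -/d.
set M4 := (\int[P]_A (l1col o A ^+ 4)%:E)%E; set E := (\int[P]_A (D A)%:E)%E.
have E0 : (0 <= E)%E by apply: integral_ge0 => A _; rewrite lee_fin.
have M0 : (0 <= M4)%E.
  by apply: integral_ge0 => A _; rewrite lee_fin exprn_ge0 ?l1col_ge0.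
(* An infinite expectation satisfies the bound trivially, and the fourth moment is finite by its
   upper bound, so real arithmetic remains. *)
case: E E0 => [r| |]; [|by move=> *; rewrite leey|by []].
case: M4 M0 => [q| |]; [|by []|by []].
rewrite -!EFinM -!EFinD !lee_fin.
move=> _ _ qb h.
pose w : R := 2 / pi.
have bw : b ^+ 2 = w := l1_limit_sqr R.
have /andP[wl wu] := two_div_pi_bounds R; rewrite -/w in wl wu.
have e1 : 2 * (d - 1) / pi = w * (d - 1) by exact: mulrAC.
have e2 : 4 * d ^+ 2 / pi ^+ 2 = d ^+ 2 * w ^+ 2.
  by rewrite /w; move: (pi : R) (pi_gt0 R) => p p0; field; rewrite gt_eqF.
(* E Z^2 = w + (1 - w) / d, and w <= 1. *)
have h2 : (7 - 3 / b) * w <= c2 * (1 + 2 * (d - 1) / pi).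
  have -> : c2 * (1 + 2 * (d - 1) / pi) = (7 - 3 / b) * ((1 + w * (d - 1)) / d).
    by rewrite e1 /c2; field; rewrite !gt_eqF.
  apply: ler_wpM2l; first by rewrite subr_ge0 ler_pdivrMr//; lra.
  rewrite ler_pdivlMr//; lra.
have h4 : c4 * q <= (3 * b - 1) / b ^+ 3 * (w ^+ 2 + 5 / d).
  apply: (@le_trans _ _ (c4 * (d ^+ 2 * (w ^+ 2 + 5 / d)))).
    apply: (ler_wpM2l c40). apply: (le_trans qb).
    have -> : 6 * (1 + 2 * (d - 1) / pi) + 4 * d ^+ 2 / pi ^+ 2 =
       6 * (1 + w * (d - 1)) + d ^+ 2 * w ^+ 2.
      by rewrite e1 e2.
    have -> : d ^+ 2 * (w ^+ 2 + 5 / d) = d ^+ 2 * w ^+ 2 + 5 * d.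
      by field; rewrite gt_eqF.
    (* Six second moments are at most 4 d + 2, which is at most 5 d because d >= 2. *)
    have : w * (d - 1) <= 2 / 3 * (d - 1) by rewrite ler_wpM2r//; lra.
    lra.
  by rewrite /c4 le_eqVlt; apply/predU1P; left; field; rewrite !gt_eqF.
have h5 : 5 * ((3 * b - 1) / b ^+ 3) / d <= a ^+ 3 * (65 / d).
  have -> : a ^+ 3 * (65 / d) = (65 * a ^+ 3) / d by ring.
  apply: ler_wpM2r; first by rewrite invr_ge0 ltW.
  rewrite mulrA ler_pdivrMr ?exprn_gt0//.
  have := tangent_slope_le R; rewrite -/a -/b; lra.
(* Equality in the minorant at Z = b, where the distance is [a]. *)
have h6 : (7 - 3 / b) * w - (3 * b - 1) / b ^+ 3 * w ^+ 2 - (6 * b - 4) = a ^+ 3 * a.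
  have -> : a ^+ 3 * a = (a ^+ 2) ^+ 2 by ring.
  by rewrite a2 -bw; field; rewrite gt_eqF.
rewrite -(@ler_pM2l _ (a ^+ 3)) ?exprn_gt0// mulrBr -h6.
have h7 : (3 * b - 1) / b ^+ 3 * (w ^+ 2 + 5 / d) =
  (3 * b - 1) / b ^+ 3 * w ^+ 2 + 5 * ((3 * b - 1) / b ^+ 3) / d by field; rewrite !gt_eqF.
rewrite h7 in h4; lra.
Qed.

Lemma supW1_ge : ((a - 65 / d)%:E <= supW1 P)%E.
Proof.
apply: (le_trans EX_cubedist_ge).
apply: (@le_trans _ _ (W1TX P e0)); last first.
  apply: ereal_sup_ubound; exists e0 => //=.
  rewrite /enorm (bigD1 (ord0_pow2 m))//= big1 ?addr0.
    by rewrite mxE !eqxx expr1n sqrtr1.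
  by move=> i ne; rewrite mxE (negPf ne) expr0n.
apply: (@le_trans _ _ `|(ET (@cubedist R m) e0)%:E - EX P (@cubedist R m) e0|%E).
  by rewrite ET_cubedist sub0e abseN lee_abs.
by apply: ereal_sup_ubound; exists (@cubedist R m) => //; exact: mindist_lip1.
Qed.

End LowerBound.

Unset Implicit Arguments. Set Strict Implicit. Set Printing Implicit Defensive.

(* d = 2 ^ m; P m is a Haar probability measure on O(2 ^ m). *)
Theorem mainTheorem11 (R : realType)
    (P : forall m : nat, probability (mxM R (2 ^ m)) R)
    (hP : forall m : nat, haar_On (P m)) :
  (forall m : nat, (256 <= 2 ^ m)%N -> ((1 / 3 : R)%:E < supW1 (P m))%E) /\
  (forall m : nat, (32768 <= 2 ^ m)%N -> ((3 / 5 : R)%:E < supW1 (P m))%E) /\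
  ((Num.sqrt (2 * (1 - Num.sqrt (2 / pi))) : R)%:E
     <= limn_einf (fun m : nat => supW1 (P m)))%E.
Proof.
have ag := dist_limit_ge R.
have num m k (x : R) : (k <= 2 ^ m)%N -> (1 < k)%N -> x < dist_limit R - 65 / k%:R ->
    (x%:E < supW1 (P m))%E.
  move=> km k1 xk; have m0 : (0 < m)%N by case: m km => //; rewrite leqNgt k1.
  apply: lt_le_trans (supW1_ge (hP m) m0); rewrite lte_fin (lt_le_trans xk)//.
  rewrite lerD2l lerN2; apply: ler_wpM2l; first lra.
  by rewrite lef_pV2 ?posrE ?ltr0n ?expn_gt0 ?ler_nat//; exact: leq_trans k1.
split; [|split].
- by move=> m km; apply: (num m _ _ km) => //; lra.
(* The threshold is 2^15, handled through its exponent; 65 / 2^15 is below the margin 0.604 -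
   0.6. *)
- move=> m km; have m15 : (15 <= m)%N.
    rewrite leqNgt; apply/negP => m14.
    have : (32768 <= 2 ^ 14)%N by apply: leq_trans km _; rewrite leq_exp2l.
    by vm_compute.
  have k1 : (1 < 2 ^ 15)%N by have := ltn_exp2l 0 15 (isT : 1 < 2)%N; rewrite expn0.
  by apply: (num m _ _ _ k1); [rewrite leq_exp2l|rewrite natrX; lra].
rewrite -/(l1_limit R) -/(dist_limit R).
have cv : (fun m => (dist_limit R - 65 / (2 ^ m)%:R)%:E) @ \oo --> (dist_limit R)%:E.
  apply: cvg_EFin; first exact: nearW.
  rewrite -[X in _ --> X]subr0; apply: cvgB; first exact: cvg_cst.
  rewrite -(mulr0 65); apply: cvgM; first exact: cvg_cst.
  under eq_fun do rewrite natrX -exprVn.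
  by apply: cvg_expr; rewrite ger0_norm ?invr_ge0// invf_lt1 ?ltr1n.
(* The constant is the lower limit of the convergent minorant, so the lower limits are compared
   through their tail infima. *)
rewrite -(cvg_limn_einf_sup cv).1 !limn_einf_lim.
apply: lee_lim; [exact: is_cvg_einfs|exact: is_cvg_einfs|].
(* Starting at index 1 ensures the hypothesis 0 < m of [supW1_ge]. *)
exists 1%N => // n /= n1; apply: le_ereal_inf_tmp => _ [k /= nk <-].
apply: ereal_inf_le; exists (dist_limit R - 65 / (2 ^ k)%:R)%:E; first by exists k.
by apply: supW1_ge => //; exact: leq_trans nk.
Qed.
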